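(* The range of the Legendre transformation $\mathscr{L}:J_0^3\to T^*J_0^1$ for elastica is the common zero set of the three functions $p_t$, $\langle p_{\dot x},\dot x\rangle$ and $\langle p_{\dot x},p_{\dot x}\rangle+\frac{4}{|\dot x|^3}\langle p_x,\dot x\rangle$. That is, $$\mathrm{range}\,\mathscr{L}=\{(t,x,\dot x,p_t,p_x,p_{\dot x})\in T^*J_0^1\mid p_t=\langle p_{\dot x},\dot x\rangle=|\dot x|^3\langle p_{\dot x},p_{\dot x}\rangle+4\langle p_x,\dot x\rangle=0\}.$$
   Context: $J^k_0$ is the open subset $\{\dot x\ne0\}$ of the $k$-th jet bundle of sections of $\mathbf{R}\times\mathbf{R}^3\to\mathbf{R}$, so $J_0^1$ has coordinates $(t,x,\dot x)$ and $J_0^3$ has coordinates $(t,x,\dot x,\ddot x,\dddot x)$ with $x,\dot x,\ddot x,\dddot x\in\mathbf{R}^3$, $\dot x\neq0$. $T^*J^1_0$ has coordinates $(t,x,\dot x,p_t,p_x,p_{\dot x})$. $\langle\cdot,\cdot\rangle$ is the Euclidean scalar product. The elastica Lagrangian is $L(x,\dot x,\ddot x)=\frac{|\ddot x|^2}{|\dot x|^3}-\frac{\langle\dot x,\ddot x\rangle^2}{|\dot x|^5}=\frac{\langle\ddot x^\perp,\ddot x^\perp\rangle}{|\dot x|^3}$, where $\perp$ denotes the component perpendicular to $\dot x$. The Legendre (Legendre-Ostrogradski) transformation $\mathscr{L}:J_0^3\to T^*J_0^1$, $(t,x,\dot x,\ddot x,\dddot x)\mapsto(t,x,\dot x,p_t,p_x,p_{\dot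 x})$, is given by $$p_{\dot x}=\frac{\partial L}{\partial\ddot x},\qquad p_x=\frac{\partial L}{\partial\dot x}-\frac{d}{dt}\frac{\partial L}{\partial\ddot x},\qquad p_t=L-\langle p_x,\dot x\rangle-\langle p_{\dot x},\ddot x\rangle,$$ with $\frac{d}{dt}$ the total derivative. *)

(* Defs.v *)
From mathcomp Require Import all_boot all_order all_algebra.
From mathcomp Require Import all_classical all_reals all_analysis.
Import Order.TTheory GRing.Theory Num.Theory.
Import numFieldNormedType.Exports.

Set Implicit Arguments.
Unset Strict Implicit.
Unset Printing Implicit Defensive.

Local Open Scope classical_set_scope.
Local Open Scope ring_scope.

Section Euclidean.
Context {R : realType}.
Implicit Types u v : 'rV[R]_3.

Definition dot u v : R := \sum_(i < 3) u 0 i * v 0 i.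

(* The library norm `|v| on row vectors is the sup norm, hence this one. *)
Definition enorm v : R := Num.sqrt (dot v v).

Definition grad (f : 'rV[R]_3 -> R) v : 'rV[R]_3 :=
  \row_(i < 3) 'D_(delta_mx 0 i : 'rV[R]_3) (f : 'rV[R]_3 -> R^o) v.

End Euclidean.

(* Coordinates on the jet bundles J^k of R x R^3 -> R and on T^*J^1: vel, acc,
   jerk are the coordinates of the first, second and third derivatives.  The
   condition vel != 0 is not part of these types; it is imposed by the sets
   J30 and TJ10 below. *)
Record jet2 (R : realType) := Jet2 {
  time2 : R; pos2 : 'rV[R]_3; vel2 : 'rV[R]_3; acc2 : 'rV[R]_3 }.

Record jet3 (R : realType) := Jet3 {
  time3 : R; pos3 : 'rV[R]_3; vel3 : 'rV[R]_3; acc3 : 'rV[R]_3;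
  jerk3 : 'rV[R]_3 }.

Record cojet1 (R : realType) := CoJet1 {
  time1 : R; pos1 : 'rV[R]_3; vel1 : 'rV[R]_3;
  p_time : R; p_pos : 'rV[R]_3; p_vel : 'rV[R]_3 }.

Definition J30 (R : realType) : set (jet3 R) := [set z | vel3 z != 0].

Definition TJ10 (R : realType) : set (cojet1 R) := [set q | vel1 q != 0].

Section Legendre.
Context {R : realType}.
Implicit Types (F L : jet2 R -> R) (y : jet2 R) (z : jet3 R).

Definition jet32 z : jet2 R := Jet2 (time3 z) (pos3 z) (vel3 z) (acc3 z).

Definition d_time F y : R :=
  derive1 (fun s => F (Jet2 s (pos2 y) (vel2 y) (acc2 y)) : R^o) (time2 y).

Definition d_pos F y : 'rV[R]_3 :=
  grad (fun u => F (Jet2 (time2 y) u (vel2 y) (acc2 y))) (pos2 y).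

Definition d_vel F y : 'rV[R]_3 :=
  grad (fun u => F (Jet2 (time2 y) (pos2 y) u (acc2 y))) (vel2 y).

Definition d_acc F y : 'rV[R]_3 :=
  grad (fun u => F (Jet2 (time2 y) (pos2 y) (vel2 y) u)) (acc2 y).

Definition total_deriv F z : R :=
  d_time F (jet32 z) + dot (d_pos F (jet32 z)) (vel3 z)
  + dot (d_vel F (jet32 z)) (acc3 z) + dot (d_acc F (jet32 z)) (jerk3 z).

Definition total_deriv_vec (G : jet2 R -> 'rV[R]_3) z : 'rV[R]_3 :=
  \row_(i < 3) total_deriv (fun y => G y 0 i) z.

Definition legendre L z : cojet1 R :=
  let pv := d_acc L (jet32 z) in
  let px := d_vel L (jet32 z) - total_deriv_vec (d_acc L) z in
  let pt := L (jet32 z) - dot px (vel3 z) - dot pv (acc3 z) in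
  CoJet1 (time3 z) (pos3 z) (vel3 z) pt px pv.

Definition elastica y : R :=
  enorm (acc2 y) ^+ 2 / enorm (vel2 y) ^+ 3
  - dot (vel2 y) (acc2 y) ^+ 2 / enorm (vel2 y) ^+ 5.

End Legendre.

(* Main.v *)
Require Import Defs.
From mathcomp Require Import all_boot all_order all_algebra.
From mathcomp Require Import all_classical all_reals all_analysis.
From mathcomp Require Import ring.
Import Order.TTheory GRing.Theory Num.Theory.
Import numFieldNormedType.Exports.

Local Open Scope classical_set_scope.
Local Open Scope ring_scope.

(** Write [v], [a], [j] for velocity, acceleration and jerk, and [r = |v|].
Differentiating [L = |a|^2 / r^3 - <v,a>^2 / r^5] gives
  [p_v = 2 a / r^3 - 2 <v,a> v / r^5], which is [2 / r^3] times the component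
  of [a] perpendicular to [v], and
  [p_x = 6 <v,a> a / r^5
         + ((2 <v,j> - |a|^2) / r^5 - 5 <v,a>^2 / r^7) v - 2 j / r^3]
(lemma [legendre_elasticaE]).  Hence [<p_v,v> = 0], while [<p_x,v> = - L] and
[|p_v|^2 = 4 L / r^3], which is the third equation; together with
[<p_v,a> = 2 L] these values also give [p_t = L + L - 2 L = 0].

Conversely, the map is not injective: it forgets the component of [a] along
[v], which corresponds to reparametrizing the curve.  Over a covector
satisfying the three equations one may therefore look for a preimage with [a]
orthogonal to [v].  Then [a = (r^3 / 2) p_v] is forced, and
[j = - (r^3 / 2) (p_x + (r / 4) |p_v|^2 v)] solves the equation for [p_x]
provided that it is itself orthogonal to [v]; that orthogonality is exactly the
third equation (lemma [legendre_elastica_image]).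

The analytic part is the computation of the partial derivatives, done with a
small calculus of Euclidean gradients: the predicate [is_grad] is stable under
differences and products, and every function to be differentiated is built from linear
forms, the squared norm and the inverse powers of the norm, the latter covered
by [is_grad_enormXV]. *)

(** * The Euclidean scalar product *)

Section Dot.
Context {R : realType}.
Implicit Types u v w : 'rV[R]_3.

Lemma dotC u v : dot u v = dot v u.
Proof. by apply: eq_bigr => i _; rewrite mulrC. Qed.

Lemma dotDl u v w : dot (u + v) w = dot u w + dot v w.
Proof.
by rewrite /dot -big_split; apply: eq_bigr => i _; rewrite mxE mulrDl.
Qed.

Lemma dotZl (c : R) u w : dot (c *: u) w = c * dot u w.
Proof. by rewrite /dot mulr_sumr; apply: eq_bigr => i _; rewrite mxE mulrA. Qed.

Lemma dotNl u w : dot (- u) w = - dot u w.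
Proof. by rewrite -scaleN1r dotZl mulN1r. Qed.

Lemma dotBl u v w : dot (u - v) w = dot u w - dot v w.
Proof. by rewrite dotDl dotNl. Qed.

Lemma dot0l w : dot 0 w = 0.
Proof. by rewrite -(scale0r w) dotZl mul0r. Qed.

Lemma dotDr u v w : dot w (u + v) = dot w u + dot w v.
Proof. by rewrite dotC dotDl !(dotC _ w). Qed.

Lemma dotZr (c : R) u w : dot w (c *: u) = c * dot w u.
Proof. by rewrite dotC dotZl dotC. Qed.

Lemma dotNr u w : dot w (- u) = - dot w u.
Proof. by rewrite dotC dotNl dotC. Qed.

Lemma dot_deltar u i : dot u (delta_mx 0 i) = u 0 i.
Proof.
rewrite /dot (bigD1 i)//= mxE !eqxx mulr1 big1 ?addr0// => j ji.
by rewrite mxE (negbTE ji) andbF mulr0.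
Qed.

Lemma dot_deltal u i : dot (delta_mx 0 i) u = u 0 i.
Proof. by rewrite dotC dot_deltar. Qed.

Lemma dot_ge0 v : 0 <= dot v v.
Proof. by apply: sumr_ge0 => i _; rewrite -expr2 sqr_ge0. Qed.

Lemma dot_gt0 v : v != 0 -> 0 < dot v v.
Proof.
move=> v0; rewrite lt0r dot_ge0 andbT; apply: contraNN v0.
rewrite psumr_eq0 => [/allP vv0|i _]; last by rewrite -expr2 sqr_ge0.
apply/eqP/rowP => i; rewrite mxE; apply/eqP.
by have := vv0 i (mem_index_enum i); rewrite /= mulf_eq0 orbb.
Qed.

Lemma sqr_enorm v : enorm v ^+ 2 = dot v v.
Proof. by rewrite sqr_sqrtr// dot_ge0. Qed.

Lemma enorm_neq0 v : v != 0 -> enorm v != 0.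
Proof. by move=> v0; rewrite gt_eqF// sqrtr_gt0 dot_gt0. Qed.

End Dot.

(** * Gradients *)

Section Gradient.
Context {R : realType}.
Implicit Types (f g : 'rV[R]_3 -> R) (u v w : 'rV[R]_3).

(** Weaker than differentiability, but enough to determine [grad], and with
the rules for differences and products inherited direction by direction from
those for [is_derive]. *)
Definition is_grad f v d :=
  forall w, is_derive v w (f : 'rV[R]_3 -> R^o) (dot d w).

Lemma gradE f v d : is_grad f v d -> grad f v = d.
Proof.
move=> fd; apply/rowP => i; rewrite mxE -dot_deltar.
by have [_ ->] := fd (delta_mx 0 i).
Qed.

(** A directional derivative is an ordinary derivative along a line; this is
what gives access to the one-variable chain rule. *)
Lemma is_derive_lineP f v w (d : R) :
  is_derive v w (f : 'rV[R]_3 -> R^o) d <->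
  is_derive (0 : R) 1 (fun h : R => f (h *: w + v)) d.
Proof.
have E : (fun h : R => h^-1 *: ((f \o shift v) (h *: w) - f v : R^o)) =
  (fun h : R => h^-1 *:
    (((fun h : R => f (h *: w + v) : R^o) \o shift 0) (h *: 1)
     - f ((0 : R) *: w + v) : R^o)).
  by apply/funext => h /=; rewrite scale0r add0r addr0 [h *: 1]mulr1.
split=> -[fv fd]; split.
- by rewrite /derivable -E.
- by rewrite -fd /derive E.
- by rewrite /derivable E.
- by rewrite -fd /derive E.
Qed.

Lemma is_grad_cst (c : R) v : is_grad (fun=> c) v 0.
Proof. by move=> w; rewrite dot0l; exact: is_derive_cst. Qed.

Lemma is_gradB f g v df dg : is_grad f v df -> is_grad g v dg ->
  is_grad (fun u => f u - g u) v (df - dg).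
Proof. by move=> fd gd w; rewrite dotBl; exact: is_deriveB. Qed.

Lemma is_gradM f g v df dg : is_grad f v df -> is_grad g v dg ->
  is_grad (fun u => f u * g u) v (f v *: dg + g v *: df).
Proof. by move=> fd gd w; rewrite dotDl !dotZl; exact: is_deriveM. Qed.

Lemma is_grad_comp (phi : R -> R) f v df (dphi : R) : is_grad f v df ->
  is_derive (f v) 1 phi dphi ->
  is_grad (fun u => phi (f u)) v (dphi *: df).
Proof.
move=> fd phid w; rewrite dotZl; apply/is_derive_lineP.
apply: (@is_derive1_comp _ phi (fun h : R => f (h *: w + v))).
  by rewrite scale0r add0r.
exact/is_derive_lineP.
Qed.

Lemma is_grad_eq f v d d' : is_grad f v d -> d = d' -> is_grad f v d'.
Proof. by move=> fd <-. Qed.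

Lemma is_grad_dotl a v : is_grad (dot a) v a.
Proof.
move=> w; apply/is_derive_lineP.
have -> : (fun h : R => dot a (h *: w + v)) = (dot a w *: id + cst (dot a v)).
  by apply/funext => h; rewrite dotDr dotZr mulrC.
by apply: is_derive_eq; rewrite addr0 [LHS]mulr1.
Qed.

Lemma is_grad_coord i v : is_grad (fun u => u 0 i) v (delta_mx 0 i).
Proof.
have -> : (fun u => u 0 i) = dot (delta_mx 0 i) :> ('rV[R]_3 -> R).
  by apply/funext => u; rewrite dot_deltal.
exact: is_grad_dotl.
Qed.

Lemma is_grad_sqdot v : is_grad (fun u => dot u u) v (2 *: v).
Proof.
move=> w; apply/is_derive_lineP.
have -> : (fun h : R => dot (h *: w + v) (h *: w + v)) =
    dot w w *: (id * id) + (2 * dot v w) *: id + cst (dot v v).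
  apply/funext => h; rewrite !(dotDr, dotDl, dotZr, dotZl) (dotC w v).
  rewrite -[RHS]/(dot w w * (h * h) + 2 * dot v w * h + dot v v). ring.
apply: is_derive_eq; rewrite dotZl /=.
rewrite /GRing.scale /=. ring.
Qed.

Lemma is_grad_enorm v : v != 0 -> is_grad enorm v ((enorm v)^-1 *: v).
Proof.
move=> v0; apply: is_grad_eq.
  apply: (is_grad_comp Num.sqrt (fun u => dot u u)); first exact: is_grad_sqdot.
  exact/is_derive1_sqrt/dot_gt0.
by rewrite scalerA invfM -/(enorm v) mulrAC mulVf ?mul1r// pnatr_eq0.
Qed.

Lemma is_grad_enormXV n v : v != 0 ->
  is_grad (fun u => (enorm u ^+ n)^-1) v (- (n%:R / enorm v ^+ n.+2) *: v).
Proof.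
move=> v0 w; have r0 := enorm_neq0 _ v0.
pose f : 'rV[R]_3 -> R := enorm ^+ n.
have fE u : f u = enorm u ^+ n by rewrite /f fctE.
have fv0 : f v != 0 by rewrite fE expf_neq0.
have [df df'] := is_deriveX n (is_grad_enorm _ v0 w).
have -> : (fun u => (enorm u ^+ n)^-1) = (fun u => (f u)^-1).
  by apply/funext => u; rewrite fE.
split; first exact: derivableV.
rewrite deriveV// df' fE !dotZl /GRing.scale /=.
(* The power rule involves n.-1, so the exponent 0 is treated apart. *)
case: n {f fE fv0 df df'} => [|n]; first by rewrite !(mul0r, mulr0, oppr0).
rewrite /= !exprS; field.
by rewrite r0 expf_neq0.
Qed.

End Gradient.

(** * The Legendre transformation of elastica *)

Section Elastica.
Context {R : realType}.
Implicit Types (y : jet2 R) (z : jet3 R).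

(** For fixed velocity the Lagrangian is a quadratic polynomial in the
acceleration, so this holds at [vel2 y = 0] too, both sides being [0] by the
convention on division by zero.  It is therefore an equality of functions of
[y], which can be differentiated in the velocity. *)
Lemma d_accE y : d_acc elastica y =
  (2 / enorm (vel2 y) ^+ 3) *: acc2 y
  - (2 * dot (vel2 y) (acc2 y) / enorm (vel2 y) ^+ 5) *: vel2 y.
Proof.
case: y => t x v a; rewrite /d_acc /=; apply: gradE.
have -> : (fun u => elastica (Jet2 t x v u)) = fun u : 'rV[R]_3 =>
   dot u u * (enorm v ^+ 3)^-1 - dot v u * dot v u * (enorm v ^+ 5)^-1.
  by apply/funext => u; rewrite /elastica /= sqr_enorm.
apply: is_grad_eq.
  apply: is_gradB.
    apply: is_gradM; first exact: is_grad_sqdot.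
    exact: is_grad_cst.
  apply: is_gradM; last exact: is_grad_cst.
  by apply: is_gradM; exact: is_grad_dotl.
apply/rowP => i; rewrite !mxE; ring.
Qed.

Lemma d_velE y : vel2 y != 0 -> d_vel elastica y =
  (5 * dot (vel2 y) (acc2 y) ^+ 2 / enorm (vel2 y) ^+ 7
   - 3 * dot (acc2 y) (acc2 y) / enorm (vel2 y) ^+ 5) *: vel2 y
  - (2 * dot (vel2 y) (acc2 y) / enorm (vel2 y) ^+ 5) *: acc2 y.
Proof.
case: y => t x v a; rewrite /d_vel /= => v0; apply: gradE.
have -> : (fun u => elastica (Jet2 t x u a)) = fun u : 'rV[R]_3 =>
   dot a a * (enorm u ^+ 3)^-1 - dot a u * dot a u * (enorm u ^+ 5)^-1.
  by apply/funext => u; rewrite /elastica /= sqr_enorm (dotC u).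
apply: is_grad_eq.
  apply: is_gradB.
    apply: is_gradM; first exact: is_grad_cst.
    exact: is_grad_enormXV.
  apply: is_gradM; last exact: is_grad_enormXV.
  by apply: is_gradM; exact: is_grad_dotl.
apply/rowP => i; rewrite !mxE (dotC a v); ring.
Qed.

Lemma total_deriv_d_accE z : vel3 z != 0 ->
  total_deriv_vec (d_acc elastica) z =
  (2 / enorm (vel3 z) ^+ 3) *: jerk3 z
  - (8 * dot (vel3 z) (acc3 z) / enorm (vel3 z) ^+ 5) *: acc3 z
  + (10 * dot (vel3 z) (acc3 z) ^+ 2 / enorm (vel3 z) ^+ 7
     - 2 * (dot (acc3 z) (acc3 z) + dot (vel3 z) (jerk3 z))
        / enorm (vel3 z) ^+ 5) *: vel3 z.
Proof.
case: z => t x v a j /= v0; apply/rowP => i; rewrite mxE.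
(* Products of elementary functions, in the shape of the rules for is_grad. *)
have -> : (fun y => d_acc elastica y 0 i) = fun y : jet2 R =>
   2 * (acc2 y 0 i * (enorm (vel2 y) ^+ 3)^-1)
   - 2 * (dot (acc2 y) (vel2 y) * vel2 y 0 i * (enorm (vel2 y) ^+ 5)^-1).
  by apply/funext => y; rewrite d_accE !mxE (dotC (acc2 y)); ring.
rewrite /total_deriv /d_time /d_pos /d_vel /d_acc /= derive1_cst.
rewrite (gradE _ _ _ (is_grad_cst _ _)) dot0l add0r.
have -> : grad (fun u => 2 * (a 0 i * (enorm u ^+ 3)^-1)
      - 2 * (dot a u * u 0 i * (enorm u ^+ 5)^-1)) v =
    (10 * dot v a * v 0 i / enorm v ^+ 7 - 6 * a 0 i / enorm v ^+ 5) *: v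
    - (2 * v 0 i / enorm v ^+ 5) *: a
    - (2 * dot v a / enorm v ^+ 5) *: delta_mx 0 i.
  apply: gradE; apply: is_grad_eq.
    apply: is_gradB.
      apply: is_gradM; first exact: is_grad_cst.
      apply: is_gradM; first exact: is_grad_cst.
      exact: is_grad_enormXV.
    apply: is_gradM; first exact: is_grad_cst.
    apply: is_gradM; last exact: is_grad_enormXV.
    by apply: is_gradM; [exact: is_grad_dotl|exact: is_grad_coord].
  apply/rowP => k; rewrite !mxE (dotC a v); ring.
have -> : grad (fun u => 2 * (u 0 i * (enorm v ^+ 3)^-1)
      - 2 * (dot u v * v 0 i * (enorm v ^+ 5)^-1)) a =
    (2 / enorm v ^+ 3) *: delta_mx 0 i - (2 * v 0 i / enorm v ^+ 5) *: v.
  under [X in grad X]eq_fun do rewrite (dotC _ v).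
  apply: gradE; apply: is_grad_eq.
    apply: is_gradB.
      apply: is_gradM; first exact: is_grad_cst.
      by apply: is_gradM; [exact: is_grad_coord|exact: is_grad_cst].
    apply: is_gradM; first exact: is_grad_cst.
    apply: is_gradM; last exact: is_grad_cst.
    by apply: is_gradM; [exact: is_grad_dotl|exact: is_grad_cst].
  apply/rowP => k; rewrite !mxE; ring.
rewrite !(dotDl, dotNl, dotZl, dot0l, dot_deltal) !mxE.
ring.
Qed.

(** The energy [p_t] vanishes because the action of a curve does not depend on
its parametrization. *)
Lemma legendre_elasticaE z : vel3 z != 0 -> legendre elastica z =
  let: Jet3 t x v a j := z in
  CoJet1 t x v 0
    ((6 * dot v a / enorm v ^+ 5) *: a
     + ((2 * dot v j - dot a a) / enorm v ^+ 5
        - 5 * dot v a ^+ 2 / enorm v ^+ 7) *: v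
     - (2 / enorm v ^+ 3) *: j)
    ((2 / enorm v ^+ 3) *: a - (2 * dot v a / enorm v ^+ 5) *: v).
Proof.
case: z => t x v a j /= v0; have r0 := enorm_neq0 _ v0.
rewrite /legendre total_deriv_d_accE// d_velE//= d_accE /=.
congr CoJet1.
  rewrite /elastica /= !(dotDl, dotNl, dotZl) (dotC a v) (dotC j v).
  rewrite -!sqr_enorm. field. exact: r0.
apply/rowP => i; rewrite !mxE; ring.
Qed.

(** For the inclusion from right to left the preimage is sought with
acceleration and jerk orthogonal to the velocity. *)
Lemma legendre_elastica_image : legendre elastica @` @J30 R =
    [set q | TJ10 q /\
      [/\ p_time q = 0,
          dot (p_vel q) (vel1 q) = 0 &
          enorm (vel1 q) ^+ 3 * dot (p_vel q) (p_vel q)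
            + 4 * dot (p_pos q) (vel1 q) = 0]].
Proof.
apply/seteqP; split=> [q [[t x v a j] v0 <-]|[t x v pt px pv]].
  have r0 := enorm_neq0 _ v0; rewrite legendre_elasticaE//=.
  split=> //=; split=> //=.
    rewrite !(dotDl, dotNl, dotZl) (dotC a v) -sqr_enorm. field. exact: r0.
  rewrite !(dotDl, dotNl, dotZl, dotDr, dotNr, dotZr) (dotC a v) (dotC j v).
  rewrite -!sqr_enorm. field. exact: r0.
rewrite /TJ10 /= => -[v0 [-> pvv E]]; have r0 := enorm_neq0 _ v0.
pose r := enorm v.
exists (Jet3 t x v ((r ^+ 3 / 2) *: pv)
  (- (r ^+ 3 / 2) *: (px + (r / 4 * dot pv pv) *: v))) => //.
rewrite legendre_elasticaE//=.
have va : dot v ((r ^+ 3 / 2) *: pv) = 0 by rewrite dotZr dotC pvv mulr0.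
(* This scalar product is - r^3 / 8 times the left-hand side of E. *)
have vj : dot v (- (r ^+ 3 / 2) *: (px + (r / 4 * dot pv pv) *: v)) = 0.
  rewrite dotZr dotDr dotZr -(sqr_enorm v) (dotC v px).
  rewrite -[RHS](mulr0 (- (r ^+ 3 / 8))) -E /r; by field.
rewrite va vj.
congr CoJet1; apply/rowP => i; rewrite !mxE.
  rewrite dotZl dotZr -/r; field. exact: r0.
rewrite -/r; field. exact: r0.
Qed.

End Elastica.

Theorem theorem4p1 (R : realType) :
  legendre elastica @` @J30 R =
    [set q | TJ10 q /\
      [/\ p_time q = 0,
          dot (p_vel q) (vel1 q) = 0 &
          dot (p_vel q) (p_vel q)
            + 4 / enorm (vel1 q) ^+ 3 * dot (p_pos q) (vel1 q) = 0]]
  /\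
  legendre elastica @` @J30 R =
    [set q | TJ10 q /\
      [/\ p_time q = 0,
          dot (p_vel q) (vel1 q) = 0 &
          enorm (vel1 q) ^+ 3 * dot (p_vel q) (p_vel q)
            + 4 * dot (p_pos q) (vel1 q) = 0]].
Proof.
split; last exact: legendre_elastica_image.
rewrite legendre_elastica_image.
apply/seteqP; split=> -[t x v pt px pv] /= [v0 [? ? E]].
  split=> //; split=> //.
  by rewrite -[RHS](mulr0 (enorm v ^+ 3)^-1) -E; field; exact: enorm_neq0.
split=> //; split=> //.
by rewrite -[RHS](mulr0 (enorm v ^+ 3)) -E; field; exact: enorm_neq0.
Qed.
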